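(* Let $K$ be a field, let $G$ be a graph, and let $I(G)\subseteq S=K[v : v\in V(G)]$ be its edge ideal. If $S/I(G)^{\ell}$ is Cohen--Macaulay for some integer $\ell\ge 3$, then $I(G)$ is a complete intersection ideal.
   Context: A graph is a finite simple graph (no loops, no multiple edges) with vertex set $V(G)$ and edge set $E(G)$. Its edge ideal is $I(G)=(xy : \{x,y\}\in E(G))\subseteq S=K[v: v\in V(G)]$. Here $I(G)^{\ell}$ is the ordinary $\ell$th power. An ideal of $S$ is a complete intersection if it is generated by a regular sequence (the zero ideal, generated by the empty sequence, included). *)

(* Defs.v *)
From HB Require Import structures.
From mathcomp Require Import all_boot all_order all_algebra.
From mathcomp Require Import mpoly.

Set Implicit Arguments.
Unset Strict Implicit.
Unset Printing Implicit Defensive.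

Import GRing.Theory.
Local Open Scope ring_scope.

Section Ideals.
Variable A : comNzRingType.
Implicit Types (I J : A -> Prop) (s : seq A).

Definition ideal I : Prop :=
  [/\ I 0, forall a b, I a -> I b -> I (a + b) & forall a b, I b -> I (a * b)].

Definition prime_ideal I : Prop :=
  [/\ ideal I, ~ I 1 & forall a b, I (a * b) -> I a \/ I b].

Definition ideal_gen (X : A -> Prop) : A -> Prop :=
  fun a => forall I, ideal I -> (forall x, X x -> I x) -> I a.

Definition ideal_mul I J : A -> Prop :=
  ideal_gen (fun c => exists a b, [/\ I a, J b & c = a * b]).

Definition ideal_exp I (l : nat) : A -> Prop :=
  iter l (ideal_mul I) (fun=> True).

Definition noetherian : Prop :=
  forall I, ideal I ->
    exists s, forall a, I a <-> ideal_gen (fun x => x \in s) a.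

Definition regular_sequence s : Prop :=
  (forall i, (i < size s)%N -> forall a,
     ideal_gen (fun x => x \in take i s) (s`_i * a) ->
     ideal_gen (fun x => x \in take i s) a)
  /\ ~ ideal_gen (fun x => x \in s) 1.

Definition complete_intersection I : Prop :=
  exists s, regular_sequence s /\
    forall a, I a <-> ideal_gen (fun x => x \in s) a.

Definition prime_chain (d : nat) (c : nat -> A -> Prop) : Prop :=
  (forall i, (i <= d)%N -> prime_ideal (c i)) /\
  (forall i, (i < d)%N ->
     (forall a, c i a -> c i.+1 a) /\ (exists a, c i.+1 a /\ ~ c i a)).

Definition krull_dim (d : nat) : Prop :=
  (exists c, prime_chain d c) /\
  (forall d' c, prime_chain d' c -> (d' <= d)%N).

(* The supremum of the lengths of the regular sequences inside I is d. *)
Definition depth I (d : nat) : Prop :=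
  let in_I s := regular_sequence s /\ (forall x, x \in s -> I x) in
  (exists s, in_I s /\ size s = d) /\
  (forall s, in_I s -> (size s <= d)%N).

End Ideals.

(* The maximal ideal of a local ring is the set of its non-units. *)
Definition cohen_macaulay_local (L : comUnitRingType) : Prop :=
  [/\ noetherian L,
      ideal (fun x : L => x \isn't a GRing.unit)
    & exists d, krull_dim L d /\ depth (fun x : L => x \isn't a GRing.unit) d].

(* f exhibits L as the localization of A at the prime ideal P; this
   determines L up to a unique isomorphism under A. *)
Definition localization_at (A : comNzRingType) (P : A -> Prop)
    (L : comUnitRingType) (f : {rmorphism A -> L}) : Prop :=
  [/\ forall s, ~ P s -> f s \is a GRing.unit,
      forall y, exists a s, ~ P s /\ y = f a / f s
    & forall a, f a = 0 -> exists s, ~ P s /\ s * a = 0].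

(* A Noetherian ring all of whose local rings are Cohen-Macaulay.  The local
   ring at P is unique up to isomorphism, hence the existential quantifier. *)
Definition cohen_macaulay (A : comNzRingType) : Prop :=
  noetherian A /\
  forall P : A -> Prop, prime_ideal P ->
    exists (L : comUnitRingType) (f : {rmorphism A -> L}),
      localization_at P f /\ cohen_macaulay_local L.

(* A / J is Cohen-Macaulay: the quotient ring is given, up to isomorphism, as
   the target Q of a surjective morphism with kernel J. *)
Definition cohen_macaulay_quotient (A : comNzRingType) (J : A -> Prop) : Prop :=
  exists (Q : comNzRingType) (f : {rmorphism A -> Q}),
    [/\ forall y, exists a, f a = y,
        forall a, f a = 0 <-> J a
      & cohen_macaulay Q].

(* The variable attached to the vertex v is 'X_(enum_rank v). *)
Definition edge_ideal (K : fieldType) (V : finType) (e : rel V) :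
    {mpoly K[#|V|]} -> Prop :=
  ideal_gen (fun m => exists x y : V,
    e x y /\ m = 'X_(enum_rank x) * 'X_(enum_rank y)).
Arguments edge_ideal : clear implicits.

(* Main.v *)
(* If a - b - c is a path, let F be a maximal independent set away from the neighbours of
   {a, b, c}, and localise at the prime generated by the variables outside F.

   If a and c are adjacent, the maximal ideal kills f = abc (ab)^(l-2), which is nonzero in
   the quotient by I^l for reasons of degree, while the dimension is positive.

   If a and c are not adjacent, the dimension is at least two. Let f = a c b^(l-1), and split
   the remaining variables into the non-neighbours u of b and the neighbours v of b. By
   maximality of F, u is (up to nilpotents) adjacent to a or c, so that u v f is a multiple,
   up to powers, of (u a)(v b)^(l-1) or (u c)(v b)^(l-1), hence zero. The punctured spectrum
   of the support of f is thus disconnected, and depth two forces f = f1 + f2 with f1, f2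
   supported on the two pieces. This is impossible: by comparing coefficients f would have order at
   least l at the prime of the variables outside F + b or at that of the variables outside
   F + a + c, but these orders are 2 < l and l - 1.

   So G is a matching, and its edges are monomials in disjoint sets of variables. *)
Require Import Defs.
From Stdlib Require Import Classical_Prop.
From mathcomp Require Import all_boot all_order all_algebra.
From mathcomp Require Import mpoly ring.

Set Implicit Arguments.
Unset Strict Implicit.
Unset Printing Implicit Defensive.

Import GRing.Theory.

(** * Ideals and their powers *)

Section IdealTheory.
Local Open Scope ring_scope.
Variable A : comNzRingType.
Implicit Types (I J : A -> Prop) (X : A -> Prop) (a b x y : A).

Lemma ideal_gen_ideal X : ideal (ideal_gen X).
Proof.
split=> [I [] // | a b Ia Ib I idI XI | a b Ib I idI XI]; case: (idI) => _ D M.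
  by apply: D; [apply: Ia | apply: Ib].
by apply: M; apply: Ib.
Qed.

Lemma mem_ideal_gen X x : X x -> ideal_gen X x.
Proof. by move=> Xx I _; apply. Qed.

Lemma idealN I a : ideal I -> I a -> I (- a).
Proof. by case=> _ _ M Ia; rewrite -mulN1r; apply: M. Qed.

Lemma idealB I a b : ideal I -> I a -> I b -> I (a - b).
Proof. by move=> idI Ia Ib; case: (idI) => _ D _; apply: D => //; apply: idealN. Qed.

Lemma ideal_sum I (T : eqType) (r : seq T) (F : T -> A) :
  ideal I -> (forall i, i \in r -> I (F i)) -> I (\sum_(i <- r) F i).
Proof.
case=> I0 D _; elim: r => [|i r IHr] FI; first by rewrite big_nil.
rewrite big_cons; apply: D; first by apply: FI; rewrite mem_head.
by apply: IHr => j rj; apply: FI; rewrite in_cons rj orbT.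
Qed.

Lemma ideal_radical I : ideal I -> ideal (fun a => exists n, I (a ^+ n)).
Proof.
case=> I0 D M; split=> [|a b [m Ia] [n Ib]|a b [n Ib]].
- by exists 1%N; rewrite expr1.
- exists (m + n)%N; rewrite exprDn; apply: ideal_sum => // i _.
  rewrite -mulr_natr mulrC; apply: (M); case: (leqP n i) => [le_ni|lt_in].
    by rewrite -(subnK le_ni) exprD mulrA; apply: M.
  have le_m : (m <= m + n - i)%N by rewrite -addnBA ?leq_addr // ltnW.
  by rewrite -(subnK le_m) exprD mulrAC; apply: M.
- by exists n; rewrite exprMn; apply: M.
Qed.

Lemma ideal_gen_nil a : ideal_gen (fun x => x \in [::]) a -> a = 0.
Proof.
move/(_ (fun b => b = 0)); apply=> //; split=> // [b c -> ->|b c ->].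
  by rewrite addr0.
by rewrite mulr0.
Qed.

Lemma ideal_gen_seq1 x a : ideal_gen (fun y => y \in [:: x]) a -> exists c, a = x * c.
Proof.
move/(_ (fun b => exists c, b = x * c)); apply=> [|y]; last first.
  by rewrite inE => /eqP->; exists 1; rewrite mulr1.
split=> [|_ _ [c ->] [d ->]|b _ [c ->]]; first by exists 0; rewrite mulr0.
  by exists (c + d); rewrite mulrDr.
by exists (b * c); rewrite mulrCA.
Qed.

Lemma ideal_exp_ideal I n : ideal (ideal_exp I n).
Proof. by case: n => [|n]; [split | apply: ideal_gen_ideal]. Qed.

Lemma ideal_exp_cons I n a b : I a -> ideal_exp I n b -> ideal_exp I n.+1 (a * b).
Proof. by move=> Ia Ib; apply: mem_ideal_gen; exists a, b. Qed.

Lemma ideal_expX I n a : I a -> ideal_exp I n (a ^+ n).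
Proof. by move=> Ia; elim: n => // n IHn; rewrite exprS; apply: ideal_exp_cons. Qed.

End IdealTheory.

(** * Regular sequences and depth two *)

Section Depth.
Local Open Scope ring_scope.
Variable A : comNzRingType.
Implicit Types (x y : A).

Definition nonzerodivisor x := forall a, x * a = 0 -> a = 0.

(** A regular sequence of length two without properness, membership in [(x)] being spelled out as
    divisibility by [x]. *)
Definition regular_pair x y :=
  nonzerodivisor x /\
  forall a, (exists c, y * a = x * c) -> exists c, a = x * c.

Lemma nonzerodivisorX x n : nonzerodivisor x -> nonzerodivisor (x ^+ n).
Proof.
move=> reg_x; elim: n => [|n IHn] a; first by rewrite mul1r.
by rewrite exprS -mulrA => /reg_x/IHn.
Qed.

Lemma regular_sequence_head x s : regular_sequence (x :: s) -> nonzerodivisor x.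
Proof.
case=> reg _ a xa0; apply: ideal_gen_nil; apply: (reg 0%N) => //=.
by rewrite xa0; case: (ideal_gen_ideal (fun z : A => z \in [::])).
Qed.

Lemma regular_sequence_pair x y s : regular_sequence [:: x, y & s] -> regular_pair x y.
Proof.
move=> reg; split; first exact: regular_sequence_head reg.
move=> a [c yac]; apply: ideal_gen_seq1; apply: (reg.1 1%N) => //=.
rewrite yac mulrC; case: (ideal_gen_ideal (fun z : A => z \in [:: x])) => _ _.
by apply; apply: mem_ideal_gen; rewrite mem_head.
Qed.

(** Two inductions: first on the exponent of [y] modulo [x], then on that of [x], peeling off one
    factor [x] and cancelling it. *)
Lemma regular_pairX x y m n : regular_pair x y -> regular_pair (x ^+ m) (y ^+ n).
Proof.
case=> reg_x reg_y; split; first exact: nonzerodivisorX.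
have{reg_y} reg_yn a : (exists c, y ^+ n * a = x * c) -> exists c, a = x * c.
  elim: n a => [|n IHn] a; first by rewrite mul1r.
  by rewrite exprSr -mulrA => /IHn/reg_y.
elim: m => [|m IHm] a [c ync]; first by exists a; rewrite mul1r.
have [a' def_a] : exists c, a = x * c.
  by apply: reg_yn; exists (x ^+ m * c); rewrite mulrA -exprS.
have [|c' def_a'] := IHm a'.
  exists c; apply/eqP; rewrite -subr_eq0; apply/eqP/reg_x.
  by rewrite mulrBr mulrCA -def_a ync exprS mulrA subrr.
by exists c'; rewrite def_a def_a' exprS mulrA.
Qed.

(* Hartshorne's connectedness argument: phi mod A1 and 0 mod A2 glue to a section away
   from V(x, y), which depth two extends. *)
Lemma depth2_extend (A1 A2 : A -> Prop) x y phi :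
    ideal A1 -> ideal A2 -> regular_pair x y ->
    (forall a, A1 a -> A2 a -> a = 0) ->
    (forall a, A1 (x * a) -> A1 a) -> (forall a, A2 (x * a) -> A2 a) ->
    (exists a1 a2, [/\ A1 a1, A2 a2 & x * phi = a1 + a2]) ->
    (exists b1 b2, [/\ A1 b1, A2 b2 & y * phi = b1 + b2]) ->
  exists c, A1 c /\ A2 (phi - c).
Proof.
move=> id1 id2 [_ reg_y] cap sat1 sat2 [a1 [a2 [A1a A2a xphi]]] [b1 [b2 [A1b A2b yphi]]].
have [_ _ M1] := id1; have [_ _ M2] := id2.
(* Both splittings compute [x * y * phi], so [y * a1 - x * b1 = x * b2 - y * a2] lies in [A1] and in
   [A2] and vanishes; regularity of [y] modulo [x] then makes [a1] a multiple of [x]. *)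
have [|c def_a1] := reg_y a1.
  exists b1; apply/eqP; rewrite -subr_eq0; apply/eqP; apply: cap.
    by apply: idealB => //; apply: M1.
  have -> : y * a1 - x * b1 = x * b2 - y * a2.
    apply/eqP; rewrite subr_eq addrAC -mulrDr [b2 + _]addrC -yphi eq_sym subr_eq.
    by rewrite -mulrDr -xphi mulrCA.
  by apply: idealB => //; apply: M2.
exists c; split; first by apply: sat1; rewrite -def_a1.
by apply: sat2; rewrite mulrBr xphi -def_a1 addrC addKr.
Qed.

End Depth.

(** * Local rings of a quotient ring *)

Section Localization.
Local Open Scope ring_scope.
Variables (A : comNzRingType) (J : A -> Prop).

(* g exhibits L as the local ring of A / J at the image of P. *)
Definition quotient_localization (P : A -> Prop) (L : comUnitRingType)
    (g : {rmorphism A -> L}) : Prop :=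
  [/\ forall s, ~ P s -> g s \is a GRing.unit,
      forall y, exists a s, ~ P s /\ y = g a / g s
    & forall a, g a = 0 <-> exists s, ~ P s /\ J (s * a)].

Lemma cohen_macaulay_localization P :
    cohen_macaulay_quotient J -> prime_ideal P -> (forall a, J a -> P a) ->
  exists (L : comUnitRingType) (g : {rmorphism A -> L}),
    quotient_localization P g /\ cohen_macaulay_local L.
Proof.
move=> [Q [h [h_onto kerh [_ cmQ]]]] [[P0 PD PM] P1 primeP] JP.
have PhP a b : h a = h b -> P a -> P b.
  move=> hab Pa; have Jba : J (b - a) by apply/kerh; rewrite rmorphB hab subrr.
  by rewrite -(subrK a b); apply: PD => //; apply: JP.
pose PQ y := exists a, h a = y /\ P a.
have PQh a : PQ (h a) -> P a by case=> b [/PhP]; apply.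
have primePQ : prime_ideal PQ.
  split; first split.
  - by exists 0; rewrite rmorph0.
  - by move=> _ _ [a [<- Pa]] [b [<- Pb]]; exists (a + b); rewrite rmorphD; split; [|apply: PD].
  - move=> y _ [b [<- Pb]]; have [a <-] := h_onto y.
    by exists (a * b); rewrite rmorphM; split; [|apply: PM].
  - by rewrite -(rmorph1 h) => /PQh.
  - move=> y z; have [a <-] := h_onto y; have [b <-] := h_onto z.
    rewrite -rmorphM => /PQh/primeP[Pa|Pb]; [left; exists a | right; exists b]; split=> //.
have [L [f [[f_unit f_onto kerf] cmL]]] := cmQ PQ primePQ.
exists L, (f \o h : {rmorphism _ -> _}); split=> //; split=> [s Ps|y|a] /=.
- by apply: f_unit => /PQh.
- have [q [t [PQt ->]]] := f_onto y; have [a def_q] := h_onto q; have [s def_t] := h_onto t.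
  exists a, s; rewrite /= def_q def_t; split=> // Ps; apply: PQt; exists s; split=> //.
- split=> [/kerf[t [PQt]]|[s [Ps /kerh]]].
    have [s def_t] := h_onto t; rewrite -def_t -rmorphM => /kerh Jsa.
    by exists s; split=> // Ps; apply: PQt; exists s.
  rewrite rmorphM => /(congr1 f); rewrite rmorphM rmorph0 => fsa.
  have fs : f (h s) \is a GRing.unit by apply: f_unit => /PQh.
  by apply: (mulrI fs); rewrite fsa mulr0.
Qed.

Variables (P : A -> Prop) (L : comUnitRingType) (g : {rmorphism A -> L}).
Hypotheses (primeP : prime_ideal P) (locg : quotient_localization P g).

Lemma quotient_localization_eq0 a : J a -> g a = 0.
Proof.
case: locg => _ _ kerg Ja; apply/kerg; exists 1; rewrite mul1r; split=> //.
by case: primeP.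
Qed.

Lemma nonunit_numer y : y \isn't a GRing.unit -> exists a s, [/\ P a, ~ P s & y = g a / g s].
Proof.
case: locg => g_unit g_onto _ nu_y; have [a [s [Ps def_y]]] := g_onto y.
have [Pa|nPa] := classic (P a); first by exists a, s.
by case/negP: nu_y; rewrite def_y unitrM unitrV !g_unit.
Qed.

(** Primes between [J] and [P] stay distinct in the local ring, so chains in [A] bound its dimension
    from below. *)
Lemma prime_chain_localization d (c : nat -> A -> Prop) :
    prime_chain d c -> (forall i a, (i <= d)%N -> J a -> c i a) ->
    (forall i a, (i <= d)%N -> c i a -> P a) ->
  exists c', @prime_chain L d c'.
Proof.
case: locg => g_unit g_onto kerg [prc strict] Jc cP.
pose c' i y := exists a s, [/\ ~ P s, c i a & y = g a / g s].
(* The extended prime contracts back to [c i]: clearing denominators puts [t * (s * a - b)] in [J],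
   hence in [c i], which contains neither [t] nor [s]. *)
have c'g i a : (i <= d)%N -> c' i (g a) -> c i a.
  move=> le_id [b [s [Ps ca def_ga]]]; have [idc c1 primec] := prc i le_id.
  have: g (s * a - b) = 0.
    by rewrite rmorphB rmorphM def_ga mulrC (divrK (g_unit _ Ps)) subrr.
  case/kerg=> t [Pt /(Jc _ _ le_id)/primec[/(cP _ _ le_id)//|csab]].
  have : c i (s * a) by rewrite -(subrK b (s * a)); case: idc => _ D _; apply: D.
  by case/primec=> // /(cP _ _ le_id).
have PM a b : ~ P a -> ~ P b -> ~ P (a * b) by case: primeP => _ _ prm Pa Pb /prm[].
exists c'; split=> [i le_id|i lt_id]; last first.
  have [sub [a [ca nca]]] := strict i lt_id; split.
    by move=> _ [b [s [Ps cb ->]]]; exists b, s; split=> //; apply: sub.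
  exists (g a); split; last by move/c'g => /(_ (ltnW lt_id)).
  by exists a, 1; rewrite rmorph1 divr1; split=> //; case: primeP.
have [[c0 cD cM] c1 primec] := prc i le_id; split; first split.
- by exists 0, 1; rewrite rmorph0 mul0r; split=> //; case: primeP.
- move=> _ _ [a [s [Ps ca ->]]] [b [t [Pt cb ->]]].
  exists (t * a + s * b), (s * t); split; first exact: PM.
    by apply: cD; apply: cM.
  have us := g_unit _ Ps; have ut := g_unit _ Pt.
  rewrite rmorphD !rmorphM invrM // mulrDl; congr (_ + _).
    by rewrite mulrACA mulrV ?mul1r.
  by rewrite [_^-1 * _]mulrC mulrACA mulrV ?mul1r.
- move=> y _ [b [t [Pt cb ->]]]; have [a [s [Ps ->]]] := g_onto y.
  exists (a * b), (s * t); split; [exact: PM | exact: cM |].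
  by rewrite !rmorphM mulrACA invrM ?g_unit // [_^-1 * _]mulrC.
- by rewrite -(rmorph1 g) => /c'g => /(_ le_id).
- move=> y z; have [a [s [Ps ->]]] := g_onto y; have [b [t [Pt ->]]] := g_onto z.
  move=> [u [r [Pr cu def]]].
  have : c' i (g (a * b)).
    exists (s * t * u), r; split=> //; first exact: cM.
    rewrite !rmorphM -mulrA -def.
    have us := g_unit _ Ps; have ut := g_unit _ Pt.
    rewrite [_ * (g b / _)]mulrACA -invrM //.
    by rewrite [in RHS]mulrCA [g t * g s]mulrC mulrV ?mulr1 // unitrM us.
  move/c'g => /(_ le_id)/primec[ca|cb]; first by left; exists a, s.
  by right; exists b, t.
Qed.

End Localization.

(** Depth equals dimension, which bounds the length of every chain. *)
Lemma cohen_macaulay_local_depth (L : comUnitRingType) d (c : nat -> L -> Prop) :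
    cohen_macaulay_local L -> prime_chain d c ->
  exists s : seq L, [/\ regular_sequence s,
    forall x, x \in s -> x \isn't a @GRing.unit L & d <= size s].
Proof.
move=> [_ _ [d0 [[_ le_d0] [[s [[reg_s in_s] sz_s]] _]]]] /le_d0 le_d.
by exists s; rewrite sz_s.
Qed.

(** * Weighted orders and primes generated by variables *)

Section Weights.
Local Open Scope ring_scope.
Variables (K : fieldType) (V : finType).
Implicit Types (w : V -> nat) (m : 'X_{1..#|V|}) (C F : {set V}) (p q : {mpoly K[#|V|]}).

Definition weight w m : nat := (\sum_v w v * m (enum_rank v))%N.

Lemma weightD w m1 m2 : weight w (m1 + m2)%MM = (weight w m1 + weight w m2)%N.
Proof. by rewrite /weight -big_split; apply: eq_bigr => v _; rewrite mnmDE mulnDr. Qed.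

Lemma weight0 w : weight w 0%MM = 0%N.
Proof. by apply: big1 => v _; rewrite mnm0E muln0. Qed.

Lemma weightMn w m k : weight w (m *+ k)%MM = (k * weight w m)%N.
Proof. by rewrite /weight big_distrr; apply: eq_bigr => v _; rewrite mulmnE mulnA mulnC. Qed.

Lemma weightU w v : weight w U_(enum_rank v)%MM = w v.
Proof.
rewrite /weight (bigD1 v) //= mnm1E eqxx muln1 big1 ?addn0 // => u ne_uv.
by rewrite mnm1E (inj_eq enum_rank_inj) eq_sym (negPf ne_uv) muln0.
Qed.

Lemma weight_eq0 w1 w2 m : (forall v, w1 v = 0 -> w2 v = 0)%N ->
  weight w1 m = 0%N -> weight w2 m = 0%N.
Proof.
move=> w12 /eqP; rewrite sum_nat_eq0 => /forall_inP w1m; apply: big1 => v _.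
by have := w1m v isT; rewrite muln_eq0 => /orP[/eqP/w12|/eqP] ->; rewrite ?muln0.
Qed.

(** For [w] the indicator of a set of vertices, this is the [d]-th power of the prime generated by
    their variables. *)
Definition weight_ge w d p := forall m, m \in msupp p -> (d <= weight w m)%N.

Lemma weight_geM w d1 d2 p q :
  weight_ge w d1 p -> weight_ge w d2 q -> weight_ge w (d1 + d2) (p * q).
Proof.
move=> wp wq m /msuppM_le/allpairsP[[m1 m2] /= [m1p m2q ->]].
by rewrite weightD leq_add ?wp ?wq.
Qed.

Lemma weight_ge_ideal w d : ideal (weight_ge w d).
Proof.
split=> [m|p q wp wq m|p q wq]; first by rewrite msupp0.
  by move/msuppD_le; rewrite mem_cat => /orP[/wp|/wq].
by rewrite -[d]add0n; apply: weight_geM.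
Qed.

Definition coordinate_ideal C := weight_ge (fun v => v \in C) 1.

Lemma not_coordinate_ideal C p : ~ coordinate_ideal C p ->
  exists2 m, m \in msupp p & weight (fun v => v \in C) m = 0%N.
Proof.
case: (boolP (all (fun m => 0 < weight (fun v => v \in C) m)%N (msupp p))) => [/allP//|].
by case/allPn=> m mp; rewrite lt0n negbK => /eqP w0 _; exists m.
Qed.

Lemma coordinate_idealX C v : coordinate_ideal C 'X_(enum_rank v) <-> v \in C.
Proof.
split=> [|Cv m /mem_msuppXP<-]; last by rewrite weightU Cv.
by move/(_ U_(enum_rank v)%MM); rewrite msuppX mem_head weightU lt0b; apply.
Qed.

(** An endomorphism of a domain whose kernel is [coordinate_ideal C], which is therefore prime. *)
Definition kill_coordinates C : {mpoly K[#|V|]} -> {mpoly K[#|V|]} :=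
  comp_mpoly [tuple if enum_val i \in C then 0 else 'X_i | i < #|V|].

Lemma kill_coordinatesX C m :
  kill_coordinates C 'X_[m] = 'X_[m] *+ (weight (fun v => v \in C) m == 0)%N.
Proof.
rewrite /kill_coordinates comp_mpolyX; have [w0|] := eqVneq.
  rewrite mpolyXE_id mulr1n; apply: eq_bigr => i _; rewrite tnth_mktuple.
  move/eqP: w0; rewrite sum_nat_eq0 => /forall_inP/(_ (enum_val i) isT).
  by rewrite enum_valK; case: ifP => //= _; rewrite mul1n => /eqP->.
rewrite sum_nat_eq0 => /forall_inPn[v _]; rewrite muln_eq0 negb_or eqb0 negbK.
case/andP=> Cv mv; rewrite (bigD1 (enum_rank v)) //= tnth_mktuple enum_rankK Cv.
by rewrite expr0n (negPf mv) mul0r.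
Qed.

Lemma kill_coordinates_eq0 C p : kill_coordinates C p = 0 <-> coordinate_ideal C p.
Proof.
have killE : kill_coordinates C p =
    \sum_(m <- msupp p | weight (fun v => v \in C) m == 0%N) p@_m *: 'X_[m].
  rewrite {1}[p]mpolyE /kill_coordinates raddf_sum [RHS]big_mkcond; apply: eq_bigr => m _.
  rewrite /= comp_mpolyZ; have := kill_coordinatesX C m; rewrite /kill_coordinates => ->.
  by case: ifP; rewrite ?scaler0.
split=> [kp0 m mp|wp]; last first.
  rewrite killE big_seq_cond big1 // => m /andP[/wp + /eqP w0].
  by rewrite w0.
rewrite lt0n; apply: contraTN mp => w0; rewrite mcoeff_msupp negbK -(mcoeff0 _ m) -kp0 killE.
rewrite raddf_sum /= big_mkcond /=.
have [mp|mp] := boolP (m \in msupp p).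
  rewrite (bigD1_seq m) ?msupp_uniq //= w0 mcoeffZ mcoeffX eqxx mulr1 big1 ?addr0 // => m' ne.
  by case: ifP => // _; rewrite mcoeffZ mcoeffX (negPf ne) mulr0.
rewrite (memN_msupp_eq0 mp) big_seq big1 // => m' m'p.
case: ifP => // _; rewrite mcoeffZ mcoeffX.
by case: eqP m'p => [->|]; [rewrite (negPf mp) | rewrite mulr0].
Qed.

Lemma coordinate_ideal_prime C : prime_ideal (coordinate_ideal C).
Proof.
split; first exact: weight_ge_ideal.
  move/(_ 0%MM); rewrite msupp1 mem_head weight0 => /(_ isT); exact/negP.
move=> p q /kill_coordinates_eq0/eqP; rewrite /kill_coordinates rmorphM mulf_eq0.
by case/orP=> /eqP kp0; [left | right]; apply/kill_coordinates_eq0.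
Qed.

(** Every monomial of a numerator in the prime contains a variable of [C], so the images of these
    variables generate the maximal ideal, and it suffices to test them against the radical of
    [I]. *)
Lemma coordinate_radical C J (L : comUnitRingType) (g : {rmorphism _ -> L}) (I : L -> Prop) y :
    quotient_localization J (coordinate_ideal C) g -> ideal I ->
    (forall v, v \in C -> exists n, I (g 'X_(enum_rank v) ^+ n)) ->
    y \isn't a GRing.unit -> exists n, I (y ^+ n).
Proof.
move=> locg idI IC /(nonunit_numer locg)[a [s [Ca _ ->]]].
have := ideal_radical idI; set R := fun _ => _ => idR; have [_ _ RM] := idR.
rewrite -/(R _) mulrC; apply: (RM); rewrite [a]mpolyE rmorph_sum.
apply: ideal_sum => // m ma /=; rewrite -mul_mpolyC rmorphM; apply: (RM).
have := Ca m ma; rewrite lt0n sum_nat_eq0 => /forall_inPn[v _].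
rewrite muln_eq0 negb_or eqb0 negbK => /andP[Cv mv].
have -> : m = ((m - U_(enum_rank v)) + U_(enum_rank v))%MM.
  by rewrite submK // lep1mP.
by rewrite mpolyXD rmorphM; apply: (RM); apply: IC.
Qed.

End Weights.

(** * Powers of edge ideals and independent sets *)

Section EdgeIdeal.
Local Open Scope ring_scope.
Variables (K : fieldType) (V : finType) (e : rel V).
Local Notation X v := ('X_(enum_rank v) : {mpoly K[#|V|]}).
Implicit Types (F : {set V}).

Lemma edge_in_ideal x y : e x y -> edge_ideal K V e (X x * X y).
Proof. by move=> exy; apply: mem_ideal_gen; exists x, y. Qed.

(** Weights add up along products of edges. This is the tool for showing that a polynomial is not in
    a power of the edge ideal. *)
Lemma edge_ideal_exp_weight w d l p : (forall x y, e x y -> (d <= w x + w y)%N) ->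
  ideal_exp (edge_ideal K V e) l p -> weight_ge w (l * d) p.
Proof.
move=> we; elim: l p => [|l IHl] p; first by move=> _ m.
apply; first exact: weight_ge_ideal.
move=> _ [a [b [Ia /IHl wb ->]]]; rewrite mulSn; apply: weight_geM => //.
apply: Ia; first exact: weight_ge_ideal.
move=> _ [x [y [exy ->]]] m; rewrite -mpolyXD => /mem_msuppXP<-.
by rewrite weightD !weightU we.
Qed.

Definition independent F := [forall x in F, forall y in F, ~~ e x y].

Lemma independentP F :
  reflect (forall x y, x \in F -> y \in F -> ~~ e x y) (independent F).
Proof.
apply: (iffP forall_inP) => [H x y Fx|H x Fx]; first by move/(_ x Fx)/forall_inP: H; apply.
by apply/forall_inP => y; apply: H.
Qed.

Lemma independentS F1 F2 : F1 \subset F2 -> independent F2 -> independent F1.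
Proof.
by move=> /subsetP s12 /independentP ind; apply/independentP => x y /s12 F2x /s12; apply: ind.
Qed.

Lemma independent_weight F x y : independent F -> e x y -> (1 <= (x \notin F) + (y \notin F))%N.
Proof.
move=> /independentP ind exy; rewrite lt0n addn_eq0 !eqb0 !negbK.
by apply: contraL exy => /andP[]; apply: ind.
Qed.

Lemma edge_ideal_exp_independent F l p : independent F ->
  ideal_exp (edge_ideal K V e) l p -> weight_ge (fun v => v \notin F) l p.
Proof.
move=> ind Ip; have we x y := @independent_weight F x y ind.
by have := edge_ideal_exp_weight we Ip; rewrite muln1.
Qed.

Lemma edge_ideal_exp_coordinate F l p : independent F -> (0 < l)%N ->
  ideal_exp (edge_ideal K V e) l p -> coordinate_ideal (~: F) p.
Proof.
move=> ind l_gt0 Ip m mp.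
have := edge_ideal_exp_independent ind Ip mp => /(leq_trans l_gt0).
by congr (_ <= _)%N; apply: eq_bigr => v _; rewrite inE.
Qed.

(** The variables of [ts] join the generators one at a time, and the joining variable witnesses
    strictness; the last prime is that of the variables outside [F]. *)
Lemma coordinate_chain F (ts : seq V) : uniq ts -> (forall v, v \in ts -> v \notin F) ->
  prime_chain (size ts)
    (fun i => coordinate_ideal (K := K) (~: (F :|: [set v in drop i ts]))).
Proof.
move=> uts Fts; split=> [i _|i lt_i]; first exact: coordinate_ideal_prime.
case: ts => [//|t0 ts] in uts Fts lt_i *; set s := t0 :: ts in uts Fts lt_i *.
have dropE := drop_nth t0 lt_i; set t := nth t0 s i in dropE.
have ut : t \notin drop i.+1 s.
  by have := drop_uniq i uts; rewrite dropE => /= /andP[].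
split=> [p cp m /cp|]; last first.
  exists (X t); rewrite !coordinate_idealX !inE dropE mem_head orbT negb_or ut.
  by rewrite Fts // mem_nth.
rewrite !lt0n; apply: contraNneq => w0; apply/eqP; apply: weight_eq0 w0 => v /eqP; rewrite eqb0.
rewrite !inE dropE inE negbK => /orP[->|->]; rewrite ?orbT //.
Qed.

(** Independence of [F] with [ts] makes the whole chain of coordinate primes contain the power, so
    the local ring has dimension, hence depth, at least [size ts]. *)
Lemma cohen_macaulay_regular_sequence l F (ts : seq V) :
    cohen_macaulay_quotient (ideal_exp (edge_ideal K V e) l) -> (0 < l)%N ->
    uniq ts -> (forall v, v \in ts -> v \notin F) -> independent (F :|: [set v in ts]) ->
  exists (L : comUnitRingType) (g : {rmorphism {mpoly K[#|V|]} -> L}) (s : seq L),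
    [/\ quotient_localization (ideal_exp (edge_ideal K V e) l) (coordinate_ideal (~: F)) g,
        regular_sequence s,
        forall x, x \in s -> x \isn't a @GRing.unit L
      & (size ts <= size s)%N].
Proof.
move=> cm l_gt0 uts Fts ind.
have primeF : prime_ideal (coordinate_ideal (K := K) (~: F)) by apply: coordinate_ideal_prime.
have indF : independent F by apply: independentS ind; apply: subsetUl.
have Jc F' : independent F' -> forall a,
    ideal_exp (edge_ideal K V e) l a -> coordinate_ideal (~: F') a.
  by move=> ind' a; apply: edge_ideal_exp_coordinate.
have [L [g [locg cmL]]] := cohen_macaulay_localization cm primeF (Jc F indF).
have [||c chain] := prime_chain_localization primeF locg (coordinate_chain uts Fts).
- move=> i a _; apply: Jc; apply: independentS ind; apply: setUS.
  by apply/subsetP => v; rewrite !inE => /mem_drop.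
- move=> i a _ ca m /ca; rewrite !lt0n; apply: contraNneq => w0; apply/eqP.
  by apply: weight_eq0 w0 => v /eqP; rewrite eqb0 !inE negbK => ->.
by have [s [reg_s nu_s le_s]] := cohen_macaulay_local_depth cmL chain; exists L, g, s.
Qed.

End EdgeIdeal.

(** * Excluding paths on three vertices *)

Section Connectedness.
Local Open Scope ring_scope.
Variables (K : fieldType) (V : finType) (e : rel V).
Hypotheses (e_sym : ssrbool.symmetric e) (e_irr : irreflexive e).
Local Notation X v := ('X_(enum_rank v) : {mpoly K[#|V|]}).
Local Notation U v := (U_(enum_rank v))%MM.
Implicit Types (F B : {set V}).

(** Take [F] maximal among the independent sets with no neighbour in [B]: a vertex adjacent to
    neither [F] nor [B] could be added to it. *)
Lemma maximal_independent_away B :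
  exists F, [/\ independent e F, forall x u, x \in F -> u \in B -> ~~ e u x
    & forall v, v \notin F -> (exists2 u, u \in F & e v u) \/ (exists2 u, u \in B & e v u)].
Proof.
pose good F := independent e F && [forall x in F, forall u in B, ~~ e u x].
have good0 : good set0.
  by apply/andP; split; [apply/independentP => x y | apply/forall_inP => x]; rewrite inE.
have [F /maxsetP[/andP[indF /forall_inP awayF] maxF] _] := maxset_exists good0.
have awayFB x u : x \in F -> u \in B -> ~~ e u x by move=> /awayF/forall_inP; apply.
exists F; split=> // v Fv.
have [/exists_inP[u Fu evu]|/exists_inPn noF] := boolP [exists u in F, e v u].
  by left; exists u.
have [/exists_inP[u Bu evu]|/exists_inPn noB] := boolP [exists u in B, e v u].
  by right; exists u.
case/negP: Fv; rewrite -(maxF (v |: F)) ?subsetUr ?setU11 //.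
apply/andP; split.
  apply/independentP => x y /setU1P[->|Fx] /setU1P[->|Fy]; rewrite ?e_irr ?noF //.
    by rewrite e_sym noF.
  by apply: (independentP _ _ indF).
apply/forall_inP => x /setU1P[->|Fx]; apply/forall_inP => u Bu; last exact: awayFB.
by rewrite e_sym noB.
Qed.

Lemma no_triangle l a b c : (2 <= l)%N ->
    cohen_macaulay_quotient (ideal_exp (edge_ideal K V e) l) ->
  e a b -> e b c -> ~~ e a c.
Proof.
case: l => [|[|k]] // _ cm eab ebc; apply/negP => eac.
set J := ideal_exp _ _ in cm.
have [F [indF awayF maxF]] := maximal_independent_away [set a; b; c].
have nFe x u : u \in [set a; b; c] -> e u x -> x \notin F.
  by move=> Bu eux; apply/negP => /awayF/(_ Bu)/negP[].
have Fa : a \notin F by apply: (nFe _ b); rewrite ?inE ?eqxx ?orbT // e_sym.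
have Fb : b \notin F by apply: (nFe _ a); rewrite ?inE ?eqxx ?orbT.
have Fc : c \notin F by apply: (nFe _ b); rewrite ?inE ?eqxx ?orbT.
(* Adding [a] to [F] keeps it independent, so the depth is at least one. *)
have [//|//|||L [g [s [locg reg_s nu_s]]]] :=
  @cohen_macaulay_regular_sequence K V e k.+2 F [:: a] cm.
- by move=> v; rewrite inE => /eqP->.
- apply/independentP => x y; rewrite !inE.
  case/orP=> [Fx|/eqP->] /orP[Fy|/eqP->]; rewrite ?e_irr //.
  + by apply: (independentP _ _ indF).
  + by rewrite e_sym awayF // !inE eqxx.
  + by rewrite awayF // !inE eqxx.
case: s reg_s nu_s => [//|x s] reg_s nu_s _.
have [_ _ kerg] := locg.
(* Here l = k + 2, and f = abc (ab)^k has degree 2l - 1. *)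
pose mf := (U a + U b + U c + (U a + U b) *+ k)%MM.
have f_def : 'X_[mf] = X a * X b * X c * (X a * X b) ^+ k :> {mpoly K[#|V|]}.
  by rewrite /mf !mpolyXD -mpolyXn mpolyXD.
have edge u v : e u v -> edge_ideal K V e (X u * X v) by apply: edge_in_ideal.
have abk : ideal_exp (edge_ideal K V e) k ((X a * X b) ^+ k) by apply: ideal_expX; apply: edge.
have f_exp : ideal_exp (edge_ideal K V e) k.+1 'X_[mf].
  rewrite f_def [_ * X c]mulrC -mulrA.
  have [_ _ M] := ideal_exp_ideal (edge_ideal K V e) k.+1.
  by apply: M; apply: ideal_exp_cons => //; apply: edge.
(* A variable v outside [F] kills f. If v has a neighbour u in [F], then u is a unit and uv f is in
   I^l because f is in I^(l-1); if v is adjacent to a vertex of the triangle, the other two form an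
   edge, so v f is a multiple of l edges. *)
have annf : exists n, x ^+ n * g 'X_[mf] = 0.
  apply: (coordinate_radical (I := fun y => y * g 'X_[mf] = 0) locg).
  - split=> [|y z y0 z0|y z z0]; first by rewrite mul0r.
      by rewrite mulrDl y0 z0 addr0.
    by rewrite -mulrA z0 mulr0.
  - move=> v; rewrite inE => Fv; exists 1%N; rewrite expr1 -rmorphM; apply/kerg.
    have [[u Fu evu]|[u Bu evu]] := maxF v Fv.
      exists (X u); rewrite coordinate_idealX inE Fu; split=> //.
      by rewrite mulrA; apply: ideal_exp_cons => //; apply: edge; rewrite e_sym.
    exists 1; split; first by case: (coordinate_ideal_prime K (~: F)).
    rewrite mul1r f_def; move: Bu evu; rewrite !inE -orbA => /or3P[] /eqP-> evu.
    + have -> : X v * (X a * X b * X c * (X a * X b) ^+ k) =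
        X v * X a * (X b * X c * (X a * X b) ^+ k) by rewrite !mulrA.
      by apply: ideal_exp_cons; [|apply: ideal_exp_cons => //]; apply: edge.
    + have -> : X v * (X a * X b * X c * (X a * X b) ^+ k) =
        X v * X b * (X a * X c * (X a * X b) ^+ k).
        by rewrite !mulrA; congr (_ * _ * _); rewrite mulrAC.
      by apply: ideal_exp_cons; [|apply: ideal_exp_cons => //]; apply: edge.
    + have -> : X v * (X a * X b * X c * (X a * X b) ^+ k) =
        X v * X c * (X a * X b * (X a * X b) ^+ k).
        by rewrite [X a * X b * X c]mulrC !mulrA.
      by apply: ideal_exp_cons; [|apply: ideal_exp_cons => //]; apply: edge.
  - by apply: nu_s; rewrite mem_head.
have [n xnf] := annf.
have := nonzerodivisorX (regular_sequence_head reg_s) xnf.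
case/kerg=> t [/not_coordinate_ideal[m mt wm0] Jtf].
(* Neighbours of [F] lie outside [F] and the triangle, so edges weigh at least 2 and I^l at least
   2l, whereas f times the monomial [m] in variables of [F] weighs 2l - 1. *)
pose w v : nat := if v \in F then 0%N else if v \in [set a; b; c] then 1%N else 2%N.
have we x' y' : e x' y' -> (2 <= w x' + w y')%N.
  move=> exy; rewrite /w; have [Fx|Fx] := boolP (x' \in F).
    have [Fy|Fy] := boolP (y' \in F).
      by rewrite (negPf (independentP _ _ indF _ _ Fx Fy)) in exy.
    have [By|//] := boolP (y' \in [set a; b; c]).
    by case/negP: (awayF _ _ Fx By); rewrite e_sym.
  have [Fy|Fy] := boolP (y' \in F); last by do 2!case: ifP.
  by have [Bx|//] := boolP (x' \in [set a; b; c]); case/negP: (awayF _ _ Fy Bx).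
have := edge_ideal_exp_weight we Jtf (m := (mf + m)%MM).
rewrite (perm_mem (msuppMX _ _)) map_f // => /(_ isT).
rewrite weightD (weight_eq0 _ wm0) => [|v]; last first.
  by rewrite /w !inE; case: (v \in F).
rewrite !weightD weightMn weightD !weightU /w (negPf Fa) (negPf Fb) (negPf Fc) !inE !eqxx !orbT /=.
by rewrite addn0 muln2 mulnC mul2n -addnn !addnS !addn0 !addSn !ltnS addnn ltnn.
Qed.

Lemma edge_transitive l a b c : (3 <= l)%N ->
    cohen_macaulay_quotient (ideal_exp (edge_ideal K V e) l) ->
  e a b -> e b c -> a != c -> e a c.
Proof.
case: l => [|[|[|k]]] // _ cm eab ebc ne_ac; apply/negP => /negP eac.
set J := ideal_exp _ _ in cm.
have [F [indF awayF maxF]] := maximal_independent_away [set a; b; c].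
have nFe x u : u \in [set a; b; c] -> e u x -> x \notin F.
  by move=> Bu eux; apply/negP => /awayF/(_ Bu)/negP[].
have Fa : a \notin F by apply: (nFe _ b); rewrite ?inE ?eqxx ?orbT // e_sym.
have Fb : b \notin F by apply: (nFe _ a); rewrite ?inE ?eqxx ?orbT.
have Fc : c \notin F by apply: (nFe _ b); rewrite ?inE ?eqxx ?orbT.
have Ba : a \in [set a; b; c] by rewrite !inE eqxx.
have Bb : b \in [set a; b; c] by rewrite !inE eqxx orbT.
have Bc : c \in [set a; b; c] by rewrite !inE eqxx orbT.
have ind_ac : independent e (F :|: [set a; c]).
  apply/independentP => x y; rewrite !inE.
  case/or3P=> [Fx|/eqP->|/eqP->] /or3P[Fy|/eqP->|/eqP->]; rewrite ?e_irr //;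
    by [apply: (independentP _ _ indF) | apply: awayF | rewrite e_sym; apply: awayF
       | rewrite e_sym].
have ind_b : independent e (F :|: [set b]).
  apply/independentP => x y; rewrite !inE.
  case/orP=> [Fx|/eqP->] /orP[Fy|/eqP->]; rewrite ?e_irr //;
    by [apply: (independentP _ _ indF) | apply: awayF | rewrite e_sym; apply: awayF].
(* Adding both [a] and [c] to [F] keeps it independent, so the depth is at least two. *)
have [//||||L [g [s [locg reg_s nu_s]]]] :=
  @cohen_macaulay_regular_sequence K V e k.+3 F [:: a; c] cm.
- by rewrite /= inE ne_ac.
- by move=> v; rewrite !inE => /orP[] /eqP->.
- by apply: etrans ind_ac; congr independent; apply/setP=> v; rewrite !inE.
case: s reg_s nu_s => [//|x [//|y s]] reg_s nu_s _.
have [_ g_onto kerg] := locg.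
have nu_x : x \isn't a GRing.unit by apply: nu_s; rewrite mem_head.
have nu_y : y \isn't a GRing.unit by apply: nu_s; rewrite !inE eqxx orbT.
have reg_xy := regular_sequence_pair reg_s.
(* Here l = k + 3, and this is the exponent of f = a c b^(l-1). *)
pose mf := (U a + U c + U b *+ k.+2)%MM.
pose phi := g 'X_[mf].
(* the elements that restrict to 0 wherever some variable of D is invertible *)
pose killed (D : {set V}) r := forall v, v \in D -> exists n, g (X v) ^+ n * r = 0.
have killed_ideal D : ideal (killed D).
  split=> [v _|r t kr kt v Dv|r t kt v Dv]; first by exists 0%N; rewrite mulr0.
    have [m rm] := kr v Dv; have [n tn] := kt v Dv; exists (m + n)%N.
    by rewrite mulrDr {1}addnC !exprD -!mulrA rm tn !mulr0 addr0.
  by have [n tn] := kt v Dv; exists n; rewrite mulrCA tn mulr0.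
have killed_sat D z r : nonzerodivisor z -> killed D (z * r) -> killed D r.
  move=> reg_z kzr v Dv; have [n zrn] := kzr v Dv; exists n; apply: reg_z.
  by rewrite mulrCA.
pose U1 := ~: F :\: [set v | e v b]; pose U2 := ~: F :&: [set v | e v b].
have edgeX u v : e u v -> J ((X u * X v) ^+ k.+3).
  by move=> euv; apply: ideal_expX; apply: edge_in_ideal.
have gJ p : J p -> g p = 0.
  by move=> Jp; apply: (quotient_localization_eq0 _ locg) => //; apply: coordinate_ideal_prime.
(* If u has a neighbour z in [F], then z is a unit and u is nilpotent. Otherwise u is adjacent to
   some w among a and c, not being a neighbour of b, and (uw)(vb)^(l-1) divides (uv)^l f. *)
have cross u v : u \in U1 -> v \in U2 -> g (X u) ^+ k.+3 * g (X v) ^+ k.+3 * phi = 0.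
  rewrite !inE => /andP[nub Fu] /andP[Fv evb]; rewrite -exprMn -rmorphM.
  have [[z Fz euz]|[z Bz euz]] := maxF u Fu.
    have gu0 : g (X u ^+ k.+3) = 0.
      apply/kerg; exists (X z ^+ k.+3); split.
        elim: k.+3 => [|n IHn]; first by case: (coordinate_ideal_prime K (~: F)).
        have [_ _ prm] := coordinate_ideal_prime K (~: F).
        by rewrite exprS => /prm[/coordinate_idealX|//]; rewrite inE Fz.
      by rewrite mulrC -exprMn; apply: edgeX.
    by rewrite rmorphM exprMn -[_ ^+ _]rmorphXn gu0 !mul0r.
  suff Jf : J ((X u * X v) ^+ k.+3 * 'X_[mf]).
    by rewrite -rmorphXn /phi -rmorphM gJ.
  have [_ _ M] := ideal_exp_ideal (edge_ideal K V e) k.+3.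
  have [w ew uw] : exists2 w, w \in [:: a; c] & e u w.
    by move: Bz euz; rewrite !inE -orbA => /or3P[]/eqP-> euz;
      [exists a | rewrite euz in nub | exists c]; rewrite ?inE ?eqxx ?orbT.
  have Jw : J (X u * X w * (X v * X b) ^+ k.+2).
    by apply: ideal_exp_cons; [|apply: ideal_expX]; apply: edge_in_ideal.
  have f_def : 'X_[mf] = X a * X c * X b ^+ k.+2 :> {mpoly K[#|V|]}.
    by rewrite /mf 2!mpolyXD -mpolyXn.
  rewrite f_def; have [w' ->] : exists w', X a * X c = X w * X w'.
    by move: ew; rewrite !inE => /orP[]/eqP->; [exists c | exists a; rewrite mulrC].
  have -> : (X u * X v) ^+ k.+3 * (X w * X w' * X b ^+ k.+2) =
      X u ^+ k.+2 * X v * X w' * (X u * X w * (X v * X b) ^+ k.+2).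
    by rewrite !exprMn !exprS; ring.
  exact: M.
have vars v : v \in ~: F -> v \in U1 \/ v \in U2.
  by rewrite !inE => ->; case: (e v b); [right | left].
(* The annihilator of such an [r] has the maximal ideal in its radical, hence contains a power of
   the nonzerodivisor [x]. *)
have killed_all r : killed U1 r -> killed U2 r -> r = 0.
  move=> k1 k2; have [n xr] : exists n, x ^+ n * r = 0.
    apply: (coordinate_radical (I := fun z => z * r = 0) locg) nu_x.
      split=> [|z t z0 t0|z t t0]; first by rewrite mul0r.
        by rewrite mulrDl z0 t0 addr0.
      by rewrite -mulrA t0 mulr0.
    by move=> v /vars[/k1|/k2].
  exact: (nonzerodivisorX reg_xy.1 xr).
(* By [cross], this ideal contains a power of each variable outside [F], the other summand being 0;
   hence it contains powers of [x] and [y]. *)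
pose split_phi z := exists a1 a2, [/\ killed U2 a1, killed U1 a2 & z * phi = a1 + a2].
have split_ideal : ideal split_phi.
  have [z1 D1 M1] := killed_ideal U1; have [z2 D2 M2] := killed_ideal U2.
  split=> [|z t [a1 [a2 [k1 k2 za]]] [b1 [b2 [l1 l2 tb]]]|z t [b1 [b2 [l1 l2 tb]]]].
  - by exists 0, 0; rewrite mul0r addr0.
  - exists (a1 + b1), (a2 + b2); split; [exact: D2 | exact: D1 |].
    by rewrite mulrDl za tb addrACA.
  - by exists (z * b1), (z * b2); split; [exact: M2 | exact: M1 |]; rewrite -mulrA tb mulrDr.
have split_vars v : v \in ~: F -> exists n, split_phi (g (X v) ^+ n).
  have kill0 D : killed D 0 by case: (killed_ideal D).
  move=> /vars[Uv|Uv]; exists k.+3.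
    exists (g (X v) ^+ k.+3 * phi), 0; rewrite addr0; split=> // u Uu.
    by exists k.+3; rewrite mulrCA mulrA; apply: cross.
  exists 0, (g (X v) ^+ k.+3 * phi); rewrite add0r; split=> // u Uu.
  by exists k.+3; rewrite mulrA; apply: cross.
have [m split_x] := coordinate_radical locg split_ideal split_vars nu_x.
have [n split_y] := coordinate_radical locg split_ideal split_vars nu_y.
have reg_xyn := regular_pairX m n reg_xy.
have [|r [kr kphi]] := depth2_extend (killed_ideal U2) (killed_ideal U1) reg_xyn _
    (fun r => killed_sat U2 _ r reg_xyn.1) (fun r => killed_sat U1 _ r reg_xyn.1)
    split_x split_y.
  by move=> r k2 k1; apply: killed_all.
(* Of the two pieces only b and a matter now: a power of b kills [phi - r] and a power of a kills
   [r]. Writing [r] as p/s' and clearing denominators turns both into memberships in [J]. *)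
have [Fb' Fa'] : b \in U1 /\ a \in U2 by rewrite !inE Fa Fb eab e_irr.
have [nb nbr] := kphi b Fb'; have [na nar] := kr a Fa'.
have [p [s' [Fs' def_r]]] := g_onto r.
have [gunit _ _] := locg; have us := gunit _ Fs'.
have /kerg[t1 [Ft1 Jt1]] : g (X b ^+ nb * (s' * 'X_[mf] - p)) = 0.
  have -> : g (X b ^+ nb * (s' * 'X_[mf] - p)) = g (X b) ^+ nb * (phi - r) * g s'.
    rewrite rmorphM rmorphB rmorphM rmorphXn -mulrA mulrBl def_r.
    by rewrite (divrK us) [phi * _]mulrC.
  by rewrite nbr mul0r.
have /kerg[t2 [Ft2 Jt2]] : g (X a ^+ na * p) = 0.
  have -> : g (X a ^+ na * p) = g (X a) ^+ na * r * g s'.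
    by rewrite rmorphM rmorphXn -mulrA def_r (divrK us).
  by rewrite nar mul0r.
have [_ _ M] := ideal_exp_ideal (edge_ideal K V e) k.+3.
have [_ _ prm] := coordinate_ideal_prime K (~: F).
pose s1 := t1 * t2 * s'; pose p1 := t1 * t2 * p.
have Jb : J ((s1 * 'X_[mf] - p1) * 'X_[U b *+ nb]).
  rewrite -mpolyXn; have := M t2 _ Jt1; congr (ideal_exp _ _ _).
  by rewrite /s1 /p1; ring.
have Ja : J (p1 * 'X_[U a *+ na]).
  by rewrite -mpolyXn; have := M t1 _ Jt2; congr (ideal_exp _ _ _); rewrite /p1; ring.
(* The monomial [be] of [s1] involves variables of [F] only, so it is invisible to all weights that
   vanish on [F]. *)
have /not_coordinate_ideal[be be_s1 wbe0] : ~ coordinate_ideal (~: F) s1.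
  by case/prm => [/prm[]|].
have wF w : (forall v, v \in F -> w v = 0%N) -> weight w be = 0%N.
  move=> wF; apply: weight_eq0 wbe0 => v /eqP; rewrite eqb0 inE negbK; exact: wF.
have [ne_ab ne_cb] : a != b /\ c != b.
  by split; [apply: contraTneq eab | apply: contraTneq ebc] => ->; rewrite e_irr.
have wmf w : weight w mf = (w a + w c + k.+2 * w b)%N.
  by rewrite /mf 2!weightD weightMn !weightU.
(* Otherwise this monomial survives in [s1 * 'X_[mf] - p1]; with weight 0 on [F] and b, only a and c
   count, and 2 < l. *)
have be_p1 : (mf + be)%MM \in msupp p1.
  apply: contraT => be_p1.
  have := edge_ideal_exp_independent ind_b Jb (m := (U b *+ nb + (mf + be))%MM).
  rewrite (perm_mem (msuppMX _ _)) map_f => [/(_ isT)|]; last first.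
    rewrite mcoeff_msupp mcoeffB mcoeffMX (memN_msupp_eq0 be_p1) subr0.
    by rewrite -mcoeff_msupp.
  rewrite 2!weightD wmf weightMn weightU wF => [|v Fv]; last by rewrite inE Fv.
  by rewrite !inE (negPf Fa) (negPf Fb) (negPf Fc) (negPf ne_ab) (negPf ne_cb) eqxx orbT !muln0.
(* With weight 0 on [F], a and c, only b^(l-1) counts, and l - 1 < l. *)
have := edge_ideal_exp_independent ind_ac Ja (m := (U a *+ na + (mf + be))%MM).
rewrite (perm_mem (msuppMX _ _)) map_f // => /(_ isT).
rewrite 2!weightD wmf weightMn weightU wF => [|v Fv]; last by rewrite inE Fv.
rewrite !inE (negPf Fa) (negPf Fb) (negPf Fc) ![b == _]eq_sym (negPf ne_ab) (negPf ne_cb).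
by rewrite !eqxx orbT !muln1 muln0 !add0n addn0 ltnn.
Qed.

Lemma cohen_macaulay_matching l a b c : (3 <= l)%N ->
    cohen_macaulay_quotient (ideal_exp (edge_ideal K V e) l) ->
  e a b -> e b c -> a = c.
Proof.
move=> l_ge3 cm eab ebc; apply/eqP; apply: contraT => ne_ac.
by have := no_triangle (ltnW l_ge3) cm eab ebc; rewrite (edge_transitive l_ge3 cm eab ebc).
Qed.

End Connectedness.

(** * Regular sequences of coprime monomials *)

Section MonomialSequence.
Local Open Scope ring_scope.
Variables (n : nat) (R : comNzRingType).
Implicit Types (m : 'X_{1..n}) (ms : seq 'X_{1..n}) (p : {mpoly R[n]}).

Definition disjoint_mnm m1 m2 := [forall j, (m1 j == 0%N) || (m2 j == 0%N)].

(** The polynomials satisfying the test form an ideal containing the generators; conversely, each of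
    their monomials is a multiple of a generator. *)
Lemma monomial_idealP ms p :
  ideal_gen (fun x => x \in [seq 'X_[m] | m <- ms]) p <->
  forall m, m \in msupp p -> has (fun m' => (m' <= m)%MM) ms.
Proof.
split=> [|msP].
  move/(_ (fun q => forall m, m \in msupp q -> has (fun m' => (m' <= m)%MM) ms)).
  apply=> [|_ /mapP[m' ms_m' ->] m /mem_msuppXP<-]; last first.
    by apply/hasP; exists m'; rewrite // lepm_refl.
  split=> [m|a b aP bP m|a b bP m]; first by rewrite msupp0.
    by move/msuppD_le; rewrite mem_cat => /orP[/aP|/bP].
  case/msuppM_le/allpairsP=> [[m1 m2] /= [_ /bP/hasP[m' ms_m' le_m'] ->]].
  by apply/hasP; exists m' => //; apply: lepm_trans le_m' (lem_addl _ _).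
rewrite [p]mpolyE; apply: ideal_sum => [|m /msP/hasP[m' ms_m' le_m']].
  exact: ideal_gen_ideal.
rewrite -(submK le_m') mpolyXD -mul_mpolyC mulrA.
have [_ _] := ideal_gen_ideal (fun x : {mpoly R[n]} => x \in [seq 'X_[m] | m <- ms]).
by apply; apply: mem_ideal_gen; apply: map_f.
Qed.

(** A monomial coprime to [mi] that divides [mi + m] already divides [m]. *)
Lemma monomial_regular_sequence ms : pairwise disjoint_mnm ms -> 0%MM \notin ms ->
  regular_sequence [seq 'X_[m] : {mpoly R[n]} | m <- ms].
Proof.
move=> /(pairwiseP 0%MM) disj ms0; split; last first.
  move/monomial_idealP => /(_ 0%MM); rewrite msupp1 mem_head => /(_ isT)/hasP[m ms_m].
  move/mnm_lepP => m_le0; case/negP: ms0; suff -> : 0%MM = m by [].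
  by apply/mnmP => j; move: (m_le0 j); rewrite mnm0E leqn0 => /eqP.
move=> i; rewrite size_map => lt_i a; rewrite -map_take (nth_map 0%MM) //.
set mi := nth _ _ _; rewrite mulrC => /monomial_idealP aP; apply/monomial_idealP => m am.
have /aP/hasP[m' tm' le_m'] : (mi + m)%MM \in msupp (a * 'X_[mi]).
  by rewrite (perm_mem (msuppMX _ _)) map_f.
apply/hasP; exists m' => //; apply/mnm_lepP => j.
have [k lt_k def_m'] := nthP 0%MM tm'.
have lt_ki : (k < i)%N by move: lt_k; rewrite size_take lt_i.
move: (disj k i (ltn_trans lt_ki lt_i) lt_i lt_ki) => /forallP/(_ j).
rewrite -(nth_take 0%MM lt_ki) def_m' => /orP[/eqP-> //|/eqP mi0].
by move/mnm_lepP: le_m' => /(_ j); rewrite mnmDE mi0.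
Qed.

End MonomialSequence.

(** * Edge ideals of matchings *)

Lemma matching_complete_intersection (K : fieldType) (V : finType) (e : rel V) :
    ssrbool.symmetric e -> irreflexive e ->
    (forall a b c, e a b -> e b c -> a = c) ->
  complete_intersection (edge_ideal K V e).
Proof.
move=> e_sym e_irr e_match.
(* Ordering the endpoints lists each edge once; a repeated generator would break regularity. *)
pose ps := [seq p : V * V <- enum {: V * V} | e p.1 p.2 & enum_rank p.1 < enum_rank p.2].
pose mon (p : V * V) := (U_(enum_rank p.1) + U_(enum_rank p.2))%MM.
have psP p : (p \in ps) = e p.1 p.2 && (enum_rank p.1 < enum_rank p.2).
  by rewrite mem_filter mem_enum andbT.
have monP p j : mon p j != 0 -> enum_val j = p.1 \/ enum_val j = p.2.
  rewrite mnmDE !mnm1E addn_eq0 !eqb0 negb_and !negbK.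
  by case/orP=> /eqP<-; rewrite enum_rankK; [left | right].
exists [seq ('X_[m])%R | m <- [seq mon p | p <- ps]]; split; last first.
  move=> a; split; apply; try exact: ideal_gen_ideal.
    move=> _ [x [y [exy ->]]]; apply: mem_ideal_gen; rewrite -mpolyXD; apply: map_f.
    have [lt_xy|lt_yx|/ord_inj/enum_rank_inj eq_xy] := ltngtP (enum_rank x) (enum_rank y).
    - by apply/mapP; exists (x, y); rewrite ?psP /= ?exy.
    - by apply/mapP; exists (y, x); rewrite ?psP /= 1?e_sym ?exy // [RHS]addmC.
    - by rewrite eq_xy e_irr in exy.
  move=> _ /mapP[_ /mapP[[x y] + ->] ->]; rewrite psP mpolyXD => /andP[/= exy _].
  exact: edge_in_ideal.
apply: monomial_regular_sequence; last first.
  apply/mapP=> -[p _ /mnmP/(_ (enum_rank p.1))/eqP].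
  by rewrite mnm0E mnmDE mnm1E eqxx.
rewrite pairwise_map; have: uniq ps by rewrite filter_uniq ?enum_uniq.
rewrite uniq_pairwise; apply: (sub_in_pairwise (P := mem ps)); last exact/allP.
move=> [x y] [x' y']; rewrite !psP /= => /andP[exy lt_xy] /andP[exy' lt_xy'] ne_pq.
apply/forallP => j; apply: contraR ne_pq; rewrite negb_or.
(* Two listed edges share the vertex of index [j]. If it has the same position in both, the matching
   property identifies them; otherwise one edge is the reverse of the other, against the
   ordering. *)
case/andP=> /monP/= vp /monP/= vq; apply/eqP.
case: vp vq => -> [] def; rewrite {}def in exy lt_xy *.
- by congr (_, _); apply: (e_match _ x'); rewrite // e_sym.
- have def_y : y = x' by apply: (e_match _ y'); rewrite // e_sym.
  by rewrite def_y ltnNge ltnW in lt_xy.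
- have def_x : x = y' by apply: (e_match _ x').
  by rewrite def_x ltnNge ltnW in lt_xy.
- by congr (_, _); apply: (e_match _ y'); rewrite // e_sym.
Qed.

Theorem theorem3p8 (K : fieldType) (V : finType) (e : rel V)
    (e_sym : ssrbool.symmetric e) (e_irr : irreflexive e) (l : nat) (l_ge3 : 3 <= l) :
  cohen_macaulay_quotient (ideal_exp (edge_ideal K V e) l) ->
  complete_intersection (edge_ideal K V e).
Proof.
move=> cm; apply: matching_complete_intersection => // a b c.
exact: cohen_macaulay_matching cm.
Qed.
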